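(* Let $n\ge 1$ and $m$ be integers with $1\le m\le n$. Then there exist uncountably many $n$-tuples $(\alpha_1,\dots,\alpha_n)\in\mathbb{L}^n$ such that $\alpha_1,\dots,\alpha_n$ are linearly independent over $\mathbb{Q}$, $e^{\alpha_i}\in\mathbb{L}$ for all $i=1,\dots,n$, and $$\operatorname{trdeg}_{\mathbb{Q}}\mathbb{Q}(\alpha_1,\dots,\alpha_n,e^{\alpha_1},\dots,e^{\alpha_n})=n+m.$$
   Context: A Liouville number is an irrational real number $\xi$ such that for each integer $n\ge 1$ there exists a rational number $p_n/q_n$ with $q_n\ge 2$ and $0<|\xi-p_n/q_n|\le q_n^{-n}$. $\mathbb{L}$ denotes the set of Liouville numbers. $\operatorname{trdeg}_K L$ denotes the transcendence degree of a field $L$ over a subfield $K$. *)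

(* Defs.v *)
From mathcomp Require Import all_boot all_order all_algebra.
From mathcomp Require Import all_classical all_reals all_analysis.
(* Without notations: they clash with those of MathComp-Analysis. *)
From mathcomp Require Import -(notations) mpoly.

Set Implicit Arguments.
Unset Strict Implicit.
Unset Printing Implicit Defensive.

Import Order.TTheory GRing.Theory Num.Theory.

Local Open Scope classical_set_scope.
Local Open Scope ring_scope.

Definition liouville {R : realType} : set R :=
  [set x | irrational x /\
     forall n : nat, (1 <= n)%N ->
       exists p q : int, [/\ (2 <= q)%R, 0 < `|x - p%:~R / q%:~R| &
                             `|x - p%:~R / q%:~R| <= q%:~R ^- n]].

(* Subfields of a field E are sets of elements of E closed under the field
   operations: in a field, [divring_closed] is exactly "being a subfield",
   because 0^-1 = 0. *)
Definition is_subfield {E : fieldType} (K : set E) : Prop :=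
  divring_closed [in K].

(* K(S) *)
Definition adjoin {E : fieldType} (K S : set E) : set E :=
  smallest is_subfield (K `|` S).

Definition linearly_independent {E : fieldType} (K : set E) (n : nat)
    (a : n.-tuple E) : Prop :=
  forall c : 'I_n -> E, (forall i, K (c i)) ->
    \sum_(i < n) c i * tnth a i = 0 -> forall i, c i = 0.

Definition algebraic_over {E : fieldType} (K : set E) (x : E) : Prop :=
  exists p : {poly E}, [/\ p \is a polyOver [in K], p != 0 & root p x].

Definition algebraically_independent {E : fieldType} (K : set E) (d : nat)
    (b : d.-tuple E) : Prop :=
  forall p : mpoly d E, p \is a mpolyOver d [in K] ->
    meval (tnth b) p = 0 -> p = 0.

Definition transcendence_basis {E : fieldType} (K L : set E) (d : nat)
    (b : d.-tuple E) : Prop :=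
  [/\ [set` b] `<=` L,
      algebraically_independent K b &
      L `<=` algebraic_over (adjoin K [set` b])].

(* trdeg_K L = d, for subfields K of L of the ambient field E.  A relation
   rather than a function, since the degree may be infinite; it determines d
   because all transcendence bases of L over K are equipotent. *)
Definition trdeg_is {E : fieldType} (K L : set E) (d : nat) : Prop :=
  exists b : d.-tuple E, transcendence_basis K L b.

(* Main.v *)
(* A real x generic in the sense of Baire has all x^k and e^{x^k} (k >= 1)
   Liouville, because the Liouville numbers are residual and residual sets pull
   back along continuous maps that are constant on no interval; and x, e^x, ...,
   e^{x^r} are algebraically independent over any given countable set A, because
   a nonzero polynomial in them is an exponential polynomial, which vanishes on
   no interval. The family x, x^2, ..., x^n settles m = 1 (the exponentials
   together with x form a transcendence basis). Adjoining to a family a new x,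
   generic over the values of all rational polynomials in its transcendence
   basis, raises n and m by 1 each. *)

Require Import Defs.
From mathcomp Require Import all_boot all_order all_algebra.
From mathcomp Require Import all_classical all_reals all_analysis.
(* Without notations: they clash with those of MathComp-Analysis. *)
From mathcomp Require Import -(notations) mpoly.
From mathcomp Require Import zify ring lra.

Set Implicit Arguments.
Unset Strict Implicit.
Unset Printing Implicit Defensive.

Import Order.TTheory GRing.Theory Num.Theory.
Import numFieldNormedType.Exports.

Local Open Scope classical_set_scope.
Local Open Scope ring_scope.

(** * Exponential polynomials on an interval *)

Lemma poly_itv_eq0 (R : realType) (u v : R) (p : {poly R}) :
  u < v -> (forall x, u < x < v -> p.[x] = 0) -> p = 0.
Proof.
move=> uv p0; apply/eqP/negPn/negP => pn0.
pose z i : R := u + (v - u) / i.+2%:R.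
have z_itv i : u < z i < v.
  rewrite /z ltrDl divr_gt0 ?subr_gt0 ?ltr0n//=.
  by rewrite -ltrBrDl ltr_pdivrMr ?ltr0n// ltr_pMr ?subr_gt0// ltr1n.
have := @max_poly_roots _ p (mkseq z (size p)) pn0.
rewrite size_mkseq ltnn => /(_ _ _)/negP; apply => //.
- by apply/allP => _ /mapP[i _ ->]; apply/rootP/p0.
- apply/mkseq_uniq => i j /addrI/mulfI; rewrite subr_eq0 gt_eqF// => /(_ isT).
  by move/invr_inj/eqP; rewrite eqr_nat => /eqP[].
Qed.

Lemma is_derive_exp_poly (R : realType) (s : seq {poly R})
    (P : {poly R} -> {poly R}) (x : R) :
  is_derive x 1 (fun y => \sum_(q <- s) (P q).[y] * expR q.[y])
    (\sum_(q <- s) ((P q)^`() + P q * q^`()).[x] * expR q.[x]).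
Proof.
elim: s => [|q s IHs].
  under [X in is_derive _ _ X]funext do rewrite big_nil.
  by rewrite big_nil; exact: is_derive_cst.
under [X in is_derive _ _ X]funext do rewrite big_cons.
have dq := is_deriveM (is_derive_poly (P q) x)
  (is_derive1_comp (is_derive_expR _) (is_derive_poly q x)).
apply: is_derive_eq.
rewrite big_cons; congr (_ + _).
rewrite hornerD hornerM /GRing.scale/=; ring.
Qed.

(** If [p] were nonzero, [p * q] would have at least the degree of [p], hence more than its
    derivative. *)
Lemma deriv_mul_add_eq0 (R : realType) (p q : {poly R}) :
  q != 0 -> p^`() + p * q = 0 -> p = 0.
Proof.
move=> q0 /eqP; rewrite addrC addr_eq0 => /eqP pq.
apply/eqP/negPn/negP => p0.
have /(congr1 (fun f => size (polyseq f))) := pq.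
rewrite size_polyN size_mul// => spq; have := lt_size_deriv p0.
rewrite -spq ltnNge -subn1 -addnBA ?leq_addr//.
by rewrite size_poly_gt0.
Qed.

(** Exponents differing by a constant have proportional exponentials, so the derivatives are
    required to be distinct. Induction on the number of exponents and, within it, on the size of the
    coefficient of the first one, which a differential operator lowers. *)
Lemma exp_poly_eq0 (R : realType) (u v : R) (s : seq {poly R})
    (P : {poly R} -> {poly R}) :
  u < v -> uniq (map (@deriv R) s) ->
  (forall x, u < x < v -> \sum_(q <- s) (P q).[x] * expR q.[x] = 0) ->
  {in s, forall q, P q = 0}.
Proof.
move=> uv; elim: s P => [//|q0 s IHs] P /= /andP[q0s us].
have [N] := ubnP (size (P q0)); elim: N P => [//|N IHN] P sP f0.
have [P0|Pn0] := eqVneq (P q0) 0.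
  move=> q; rewrite inE => /predU1P[->//|]; apply: IHs => // x /f0.
  by rewrite big_cons P0 horner0 mul0r add0r.
(* [f' - q0' f], where [f] is the given sum, vanishes as well; its coefficients
   are [Q q], and [Q q0] is the derivative of [P q0]. *)
pose Q q := (P q)^`() + P q * (q^`() - q0^`()).
have Q0 : {in q0 :: s, forall q, Q q = 0}.
  apply: IHN => [|x xuv].
    rewrite /Q subrr mulr0 addr0; have := lt_size_deriv Pn0; lia.
  pose f y := \sum_(q <- q0 :: s) (P q).[y] * expR q.[y].
  have df := is_derive_exp_poly (q0 :: s) P x.
  have f'0 : is_derive x 1 f 0.
    apply: (@near_eq_is_derive _ _ _ (cst 0)).
    have := @near_in_itvoo _ u v x; rewrite in_itv/= => /(_ xuv).
    by apply: filterS => y; rewrite in_itv/= => /f0.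
  set f'sum := (X in is_derive _ _ _ X) in df.
  have := @derive.derive_val _ _ _ _ _ _ _ df.
  rewrite (@derive.derive_val _ _ _ _ _ _ _ f'0) => f'E.
  have : f'sum - q0^`().[x] * f x = 0.
    by rewrite -f'E /f f0// mulr0 subr0.
  apply: etrans; rewrite mulr_sumr -sumrB; apply: eq_bigr => q _.
  rewrite /Q !(hornerD, hornerM, hornerN); ring.
have P0 q : q \in s -> P q = 0.
  move=> qs; apply: (@deriv_mul_add_eq0 _ _ (q^`() - q0^`())).
    by rewrite subr_eq0; apply: contraNneq q0s => <-; exact: map_f.
  by apply: Q0; rewrite inE qs orbT.
move=> q; rewrite inE => /predU1P[->|/P0//].
apply: (poly_itv_eq0 uv) => x /f0; rewrite big_cons big_seq big1 ?addr0.
  by move/eqP; rewrite mulf_eq0 (gt_eqF (expR_gt0 _)) orbF => /eqP.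
by move=> r /P0 ->; rewrite horner0 mul0r.
Qed.

(** * Polynomials in a real and exponentials of its powers *)

(** Slot 0, where the exponential would be the constant e, carries [x] itself. *)
Definition pow_exps (R : realType) (r : nat) (x : R) : r.+1.-tuple R :=
  [tuple if i == ord0 then x else expR (x ^+ i) | i < r.+1].

(** Terms are grouped by exponent: [s] lists the exponents that occur, and [P q] collects the powers
    of [x] that multiply [expR q.[x]]. *)
Lemma meval_pow_expsE (R : realType) (r : nat) (p : mpoly r.+1 R) :
  exists s : seq {poly R}, exists P : {poly R} -> {poly R},
    [/\ uniq (map (@deriv R) s),
        {in s, forall q, P q = 0} -> p = 0 &
        forall x, meval (tnth (pow_exps r x)) p =
          \sum_(q <- s) (P q).[x] * expR q.[x]].
Proof.
(* At [pow_exps r x] the monomial [m] takes the value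
   [x ^+ m ord0 * expR (e m).[x]]. *)
pose e (m : multinom r.+1) : {poly R} :=
  \poly_(i < r.+1) (if i == 0%N then 0 else (m (inord i))%:R).
have e_inj m m' : (e m)^`() = (e m')^`() -> m ord0 = m' ord0 -> m = m'.
  move=> emm' mm'0; apply/mnmP => i.
  have [->//|i0] := eqVneq i ord0.
  have i1 : (val i).-1.+1 = i by rewrite prednK// lt0n.
  move/(congr1 (fun f : {poly R} => f`_(val i).-1)): emm'.
  rewrite !coef_deriv i1 !coef_poly ltn_ord inord_val (_ : val i == 0 = false);
    last exact: negbTE i0.
  by move/pmulrnI => /(_ _)/eqP; rewrite eqr_nat lt0n => /(_ i0)/eqP.
(* The exponents have no constant term, so their derivatives determine them. *)
have e_deriv m m' : (e m)^`() = (e m')^`() -> e m = e m'.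
  move=> emm'; apply/polyP => -[|i]; rewrite !coef_poly//.
  move/(congr1 (fun f : {poly R} => f`_i)): emm'.
  by rewrite !coef_deriv !coef_poly; case: ifP => // _ /pmulrnI; exact.
pose s := undup (map e (msupp p)).
pose P q := \sum_(m <- msupp p | e m == q) mcoeff m p *: 'X^(m ord0).
exists s, P; split.
- rewrite map_inj_in_uniq ?undup_uniq// => q q'; rewrite !mem_undup.
  by move=> /mapP[m _ ->] /mapP[m' _ ->]; exact: e_deriv.
- move=> P0; apply/mpolyP => m; rewrite mcoeff0.
  have [mp|/memN_msupp_eq0//] := boolP (m \in msupp p).
  have : (P (e m))`_(m ord0) = 0.
    by rewrite P0 ?coef0// mem_undup map_f.
  rewrite coef_sum big_mkcond (bigD1_seq m)//=.
  rewrite eqxx coefZ coefXn eqxx mulr1 big1 ?addr0// => m' m'm.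
  case: eqP => // em; rewrite coefZ coefXn; case: eqP; rewrite ?mulr0// => mm0.
  by case/eqP: m'm; apply: e_inj; rewrite ?em.
- move=> x; rewrite mevalE.
  under [RHS]eq_bigr do rewrite horner_sum mulr_suml.
  rewrite (exchange_big_dep xpredT)//= big_seq [RHS]big_seq.
  apply: eq_bigr => m mp.
  rewrite -[RHS]big_filter (eq_filter (a2 := pred1 (e m)));
    last by move=> q; rewrite /= eq_sym.
  rewrite filter_pred1_uniq ?undup_uniq ?mem_undup ?map_f// big_seq1.
  rewrite hornerZ hornerXn -mulrA; congr (_ * _).
  rewrite big_ord_recl tnth_mktuple eqxx; congr (_ * _).
  rewrite horner_poly big_ord_recl/= mul0r add0r expR_sum; apply: eq_bigr => i _.
  rewrite tnth_mktuple/= -expRM_natl; congr (expR (_%:R * _)).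
  by congr (m _); rewrite -[LHS]inord_val.
Qed.

Lemma meval_pow_exps_eq0 (R : realType) (u v : R) (r : nat) (p : mpoly r.+1 R) :
  u < v -> (forall x, u < x < v -> meval (tnth (pow_exps r x)) p = 0) -> p = 0.
Proof.
move=> uv p0; have [s [P [us P0 pE]]] := meval_pow_expsE p.
by apply/P0/(exp_poly_eq0 uv us) => x /p0; rewrite pE.
Qed.

Lemma continuous_meval_pow_exps (R : realType) (r : nat) (p : mpoly r.+1 R) :
  continuous (fun x : R => meval (tnth (pow_exps r x)) p).
Proof.
have [s [P [_ _ pE]]] := meval_pow_expsE p.
under eq_fun do rewrite pE.
move=> x; apply/differentiable_continuous/derivable1_diffP.
by have [] := is_derive_exp_poly s P x.
Qed.

(** * Residual sets *)

Definition residual (T : topologicalType) (S : set T) :=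
  exists2 F : (set T)^nat,
    (forall i, open (F i) /\ dense (F i)) & \bigcap_i F i `<=` S.

Lemma residual_open_dense (T : topologicalType) (U : set T) :
  open U -> dense U -> residual U.
Proof. by move=> oU dU; exists (fun=> U) => // x Ux; exact: (Ux 0%N). Qed.

Lemma residual_sub (T : topologicalType) (A B : set T) :
  A `<=` B -> residual A -> residual B.
Proof. by move=> AB [F oF FA]; exists F => //; exact: subset_trans AB. Qed.

(** The sequences of open dense sets chosen for the indices are merged into one along an enumeration
    of pairs. *)
Lemma residual_bigcap (T : topologicalType) (J : Type) (D : set J)
    (S : J -> set T) :
  countable D -> (forall i, D i -> residual (S i)) ->
  residual (\bigcap_(i in D) S i).
Proof.
move=> /countable_injP[f f_inj] rS.
have odT : open [set: T] /\ dense [set: T].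
  by split; [exact: openT|move=> O O0 _; rewrite setIT].
have {}rS i : exists F : (set T)^nat, (forall n, open (F n) /\ dense (F n)) /\
    (D i -> \bigcap_n F n `<=` S i).
  have [/rS[F oF FS]|nDi] := pselect (D i); first by exists F.
  by exists (fun=> setT).
have [F oF] := choice rS.
have [g gP] : exists g : nat -> option J, forall i, D i -> g (f i) = Some i.
  have /choice[g gP] : forall n, exists o : option J,
      forall i, D i -> f i = n -> o = Some i.
    move=> n; have [[i [Di fin]]|no] := pselect (exists i, D i /\ f i = n).
      exists (Some i) => j Dj fjn; congr Some.
      by apply: f_inj; rewrite ?inE// fin fjn.
    by exists None => i Di fin; case: no; exists i.
  by exists g => i Di; exact: gP.
(* The partial inverse [g] of [f] decodes the index; numbers that code no pair or no index give the
   whole space. *)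
pose G k := if @unpickle (nat * nat)%type k is Some (a, b) then
  (if g a is Some i then F i b else setT) else setT.
exists G => [k|x Gx i Di].
  rewrite /G; case: unpickle => [[a b]|//]; case: (g a) => [i|//].
  by have [] := oF i.
apply: (proj2 (oF i)) => // b _.
by have := Gx (pickle (f i, b)) I; rewrite /G pickleK gP.
Qed.

Lemma residualI (T : topologicalType) (A B : set T) :
  residual A -> residual B -> residual (A `&` B).
Proof.
move=> rA rB; rewrite -bigcap2E; apply: residual_bigcap => [//|[|[|i]] _] //=.
by apply: residual_open_dense; [exact: openT|move=> O O0 _; rewrite setIT].
Qed.

Lemma residual_nonempty (R : realType) (S : set R) : residual S -> S !=set0.
Proof.
move=> [F oF FS]; have /(_ setT) := Baire oF.
by rewrite setTI => /(_ (ex_intro _ 0 I) openT) [x /FS]; exists x.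
Qed.

Lemma residual_countableC (R : realType) (C : set R) :
  countable C -> residual (~` C).
Proof.
move=> cC; apply: (@residual_sub _ (\bigcap_(c in C) ~` [set c])).
  by move=> x Cx Cx'; exact: (Cx x).
apply: residual_bigcap => // c _; apply: residual_open_dense.
  by rewrite openC; exact/accessible_closed_set1/hausdorff_accessible/Rhausdorff.
exact: dense_set1C.
Qed.

Lemma open_itv_sub (R : realType) (O : set R) :
  open O -> O !=set0 -> exists u v, u < v /\ `]u, v[ `<=` O.
Proof.
move=> oO [x Ox]; have /nbhs_ballP[e /= e0 xeO] := open_nbhs_nbhs (conj oO Ox).
exists (x - e), (x + e); split; first by rewrite ltrBlDr -addrA ltrDl addr_gt0.
by rewrite -ball_itv.
Qed.

(** On any interval [f] takes two distinct values, hence all values between them. A dense open set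
    contains one of these, so its preimage is dense. *)
Lemma residual_preimage (R : realType) (f : R -> R) (S : set R) :
  continuous f ->
  (forall u v c, u < v -> exists2 x, u < x < v & f x != c) ->
  residual S -> residual (f @^-1` S).
Proof.
move=> cf ncf [F oF FS]; exists (fun n => f @^-1` F n); last first.
  by move=> x Fx; apply: FS => n _; exact: Fx.
move=> n; have [oFn dFn] := oF n; split; first exact: open_comp.
move=> O O0 oO; have [u [v [uv uvO]]] := open_itv_sub oO O0.
pose w := (u + v) / 2.
have uwv : u < w < v by rewrite /w; apply/andP; split; lra.
have [x uxv fxw] := ncf u v (f w) uv.
have [a [b [a_itv b_itv ab]]] :
    exists a b, [/\ u < a < v, u < b < v & f a < f b].
  by move: fxw; case: ltgtP => // fxw _; [exists x, w|exists w, x].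
have mM : `]f a, f b[ !=set0.
  by exists ((f a + f b) / 2); rewrite /= in_itv/=; apply/andP; split; lra.
have [y [/=]] := dFn _ mM (itv_open _ _).
rewrite in_itv/= => /andP[ay yb] Fy.
have [z zab fzy] : exists2 z, u < z < v & f z = y.
  have [leab|leba] := leP a b.
    have [||z] := @IVT R f a b y leab.
    - exact: continuous_subspaceT.
    - by rewrite ge_min le_max (ltW ay) (ltW yb) orbT.
    - by rewrite in_itv/= => /andP[az zb] fz; exists z => //; apply/andP; split; lra.
  have [||z] := @IVT R f b a y (ltW leba).
  - exact: continuous_subspaceT.
  - by rewrite ge_min le_max (ltW ay) (ltW yb) orbT.
  - by rewrite in_itv/= => /andP[az zb] fz; exists z => //; apply/andP; split; lra.
by exists z; split; [apply: uvO; rewrite /= in_itv|rewrite /= fzy].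
Qed.

(** * Residuality of the Liouville numbers *)

Lemma countable_rational (R : realType) : countable (@rational R).
Proof. exact: sub_countable (card_image_le _ _) (countableP _). Qed.

(** [U n] is open and contains every rational, hence is dense. Removing the rationals also makes the
    distances to [p / q] nonzero. *)
Lemma residual_liouville (R : realType) : residual (@liouville R).
Proof.
pose U (n : nat) : set R := \bigcup_(pq in [set pq : int * int | (2 <= pq.2)%R])
  ball (pq.1%:~R / pq.2%:~R : R) (pq.2%:~R ^- n).
apply: (@residual_sub _ ((~` @rational R) `&` \bigcap_n U n)).
  move=> x [xirr Ux]; split=> // n _.
  have [[p q] /= q2 xpq] := Ux n I; exists p, q; split => //.
    rewrite normr_gt0 subr_eq0; apply/eqP => xE; apply: xirr.
    by exists (p%:~R / q%:~R) => //; rewrite xE fmorph_div !rmorph_int.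
  by rewrite distrC ltW.
apply: residualI.
  exact: residual_countableC (countable_rational R).
apply: residual_bigcap => // n _; apply: residual_open_dense.
  apply: bigcup_open => -[p q] /= q2; exact: ball_open.
move=> O O0 oO; have [x [Ox [r _ rx]]] := dense_rat O0 oO.
exists x; split=> //; rewrite -rx.
(* The fraction is doubled to make the denominator at least 2. *)
exists (2 * numq r, 2 * denq r) => /=.
  by rewrite -[leLHS]mulr1 ler_pM2l// -gtz0_ge1 denq_gt0.
rewrite !intrM -mulf_div divff ?mul1r ?intr_eq0//.
by apply: ballxx; rewrite invr_gt0 exprn_gt0// mulr_gt0// ltr0z denq_gt0.
Qed.

(** * Generic reals *)

(** Only coefficients on the support are tested, so [A] need not contain 0. *)
Lemma mpolyOver_inP (R : realType) (n : nat) (A : set R) (p : mpoly n R) :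
  p \is a mpolyOver n [in A] <-> {in msupp p, forall m, A (mcoeff m p)}.
Proof.
rewrite qualifE /=; split=> [/allP pA m mp|pA].
  by apply/set_mem/pA/map_f.
by apply/allP => _ /mapP[m mp ->]; apply/mem_set/pA.
Qed.

Lemma countable_mpolyOver (R : realType) (n : nat) (A : set R) :
  countable A -> countable [set p : mpoly n R | p \is a mpolyOver n [in A]].
Proof.
move=> /countable_injP[f f_inj]; apply/countable_injP.
exists (fun p => pickle [seq (m, f (mcoeff m p)) | m <- msupp p]).
move=> p q /set_mem/mpolyOver_inP pA /set_mem/mpolyOver_inP qA.
move=> /(pcan_inj (@pickleK _)) pq.
have supp_pq : msupp p = msupp q.
  rewrite -[LHS]map_id -[RHS]map_id.
  by move/(congr1 unzip1): pq; rewrite /unzip1 -!map_comp.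
apply/mpolyP => m.
have [mp|mp] := boolP (m \in msupp p); last first.
  by rewrite !memN_msupp_eq0// -supp_pq.
apply: f_inj; rewrite ?inE; [exact: pA|by apply: qA; rewrite -supp_pq|].
by move: pq; rewrite -supp_pq => /eq_in_map/(_ m mp)[].
Qed.

(** Each nonzero polynomial over [A] excludes a closed set of reals that contains no interval, and
    there are countably many such polynomials. *)
Lemma residual_alg_indep (R : realType) (A : set R) (r : nat) :
  countable A ->
  residual [set x : R | algebraically_independent A (pow_exps r x)].
Proof.
move=> cA.
pose D := [set p : mpoly r.+1 R | p \is a mpolyOver _ [in A] /\ p != 0].
apply: (@residual_sub _ (\bigcap_(p in D)
    [set x | meval (tnth (pow_exps r x)) p != 0])).
  move=> x Dx p pA px; apply/eqP/negPn/negP => p0.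
  by have := Dx p (conj pA p0); rewrite /= px eqxx.
apply: residual_bigcap => [|p [_ p0]].
  apply: sub_countable (countable_mpolyOver _ cA).
  by apply: subset_card_le => p [].
apply: residual_open_dense.
  apply: (@open_comp _ _ (fun x => meval (tnth (pow_exps r x)) p) [set y | y != 0]).
    by move=> x _; exact: continuous_meval_pow_exps.
  exact: open_neq.
move=> O O0 oO; have [u [v [uv uvO]]] := open_itv_sub oO O0.
apply/not_existsP => no; move/eqP: p0; apply.
apply: (meval_pow_exps_eq0 uv) => x xuv; apply/eqP/negPn/negP => px.
by apply: (no x); split=> //; apply: uvO; rewrite /= in_itv.
Qed.

Lemma exprn_not_constant (R : realType) (k : nat) (u v c : R) :
  (0 < k)%N -> u < v -> exists2 x, u < x < v & x ^+ k != c.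
Proof.
move=> k0 uv; apply: contrapT => no.
have : 'X^k - c%:P = 0 :> {poly R}.
  apply: (poly_itv_eq0 uv) => x xuv; rewrite !hornerE.
  by apply/eqP/negPn/negP; rewrite subr_eq0 => xkc; apply: no; exists x.
by move/eqP; rewrite -size_poly_eq0 size_XnsubC.
Qed.

Lemma residual_liouville_pow (R : realType) (k : nat) : (0 < k)%N ->
  residual [set x : R | liouville (x ^+ k) /\ liouville (expR (x ^+ k))].
Proof.
move=> k0; apply: residualI.
  apply: (@residual_preimage _ (fun x => x ^+ k)); last exact: residual_liouville.
    exact: exprn_continuous.
  by move=> u v c; exact: exprn_not_constant.
apply: (@residual_preimage _ (fun x => expR (x ^+ k))); last first.
- exact: residual_liouville.
(* For [c] not positive [ln c] is a default value, which does no harm: only [ln (expR y) = y] is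
   used. *)
- move=> u v c uv; have [x xuv xk] := exprn_not_constant (ln c) k0 uv.
  by exists x => //; apply: contraNneq xk => <-; rewrite expRK.
- move=> x; apply: continuous_comp; first exact: exprn_continuous.
  exact: continuous_expR.
Qed.

(** Avoiding [C] serves two ends: uncountability, and linear independence of a new entry from the
    earlier ones. *)
Lemma exists_generic (R : realType) (A C : set R) (r : nat) :
  countable A -> countable C ->
  exists x : R, [/\ ~ C x, algebraically_independent A (pow_exps r x) &
    forall k, (0 < k)%N -> liouville (x ^+ k) /\ liouville (expR (x ^+ k))].
Proof.
move=> cA cC.
have [x [Cx [Ax Lx]]] := residual_nonempty (residualI (residual_countableC cC)
  (residualI (residual_alg_indep r cA)
  (@residual_bigcap _ _ [set k | (0 < k)%N] _ (countableP _)
    (@residual_liouville_pow R)))).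
by exists x.
Qed.

(** * Algebraic independence in two stages *)

(** For a subfield [K] this is the ring [K[b]]. It stands in for the field [K(b)]: independence over
    the two is the same after clearing denominators. *)
Definition poly_values (R : realType) (K : set R) (d : nat) (b : d.-tuple R) :
    set R :=
  meval (tnth b) @` [set p | p \is a mpolyOver d [in K]].

(** A relation is read as a polynomial in the last variables: independence of [c] makes its
    coefficients vanish at [b], then independence of [b] makes them zero. *)
Lemma alg_indep_cat (R : realType) (K : set R) (d e : nat)
    (b : d.-tuple R) (c : e.-tuple R) :
  algebraically_independent K b ->
  algebraically_independent (poly_values K b) c ->
  algebraically_independent K [tuple of b ++ c].
Proof.
move=> b_ind c_ind p /mpolyOver_inP pK p0.
(* [F m2] is the coefficient of the monomial [m2] of the last [e] variables, a
   polynomial in the first [d] ones; [q] is [p] with these evaluated at [b]. *)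
pose lm (m : multinom (d + e)) := Multinom [tuple m (lshift e i) | i < d].
pose rm (m : multinom (d + e)) := Multinom [tuple m (rshift d i) | i < e].
pose F m2 := \sum_(m <- msupp p | rm m == m2) mcoeff m p *: mpolyX R (lm m).
(* A monomial is determined by its two halves, so no terms of [p] merge in [F]. *)
have FE m1 : mcoeff (lm m1) (F (rm m1)) = mcoeff m1 p.
  rewrite raddf_sum/= (eq_bigr (fun m => if m == m1 then mcoeff m p else 0)).
    rewrite -big_mkcondr.
    have [m1p|m1p] := boolP (m1 \in msupp p); last first.
      rewrite memN_msupp_eq0// big_seq_cond big1// => m /and3P[mp _ /eqP mm1].
      by rewrite -mm1 mp in m1p.
    rewrite big_mkcond/= (bigD1_seq m1)//= !eqxx big1 ?addr0// => m.
    by move/negbTE => ->; rewrite andbF.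
  move=> m /eqP rmE; rewrite mcoeffZ mcoeffX.
  have [->|mm1] := eqVneq m m1; first by rewrite eqxx mulr1.
  case: eqP => [lmE|]; rewrite ?mulr0//; case/eqP: mm1; apply/mnmP => i.
  case: (split_ordP i) => j ->.
    by have /mnmP/(_ j) := lmE; rewrite !multinomE !tnth_mktuple.
  by have /mnmP/(_ j) := rmE; rewrite !multinomE !tnth_mktuple.
have FK m2 : F m2 \is a mpolyOver d [in K].
  apply/mpolyOver_inP => m1.
  pose m := Multinom (cat_tuple m1 m2).
  have -> : m1 = lm m.
    by apply/mnmP => i; rewrite !multinomE !tnth_mktuple multinomE tnth_lshift.
  have -> : m2 = rm m.
    by apply/mnmP => i; rewrite !multinomE !tnth_mktuple multinomE tnth_rshift.
  rewrite mcoeff_msupp FE => mp; apply: pK.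
  by rewrite mcoeff_msupp.
pose q : mpoly e R :=
  \sum_(m <- msupp p) (mcoeff m p * \prod_i tnth b i ^+ lm m i) *: mpolyX R (rm m).
have qE m2 : mcoeff m2 q = meval (tnth b) (F m2).
  rewrite /q /F !raddf_sum/= [RHS]big_mkcond; apply: eq_bigr => m _.
  rewrite mcoeffZ mcoeffX; case: eqP => _; last by rewrite mulr0.
  by rewrite mulr1 mevalZ mevalX.
have q0 : q = 0.
  apply: c_ind.
    by apply/mpolyOver_inP => m _; rewrite qE; exists (F m); first exact: FK.
  rewrite -[RHS]p0 [RHS]mevalE /q raddf_sum/=; apply: eq_bigr => m _.
  rewrite mevalZ mevalX -mulrA; congr (_ * _).
  rewrite big_split_ord/=; congr (_ * _); apply: eq_bigr => i _.
    by rewrite tnth_lshift multinomE tnth_mktuple.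
  by rewrite tnth_rshift multinomE tnth_mktuple.
apply/mpolyP => m; rewrite -FE mcoeff0.
rewrite (b_ind (F (rm m)) (FK _)) ?mcoeff0//.
by rewrite -qE q0 mcoeff0.
Qed.

(** * Generated subfields and Liouville families *)

Lemma is_subfield_adjoin (E : fieldType) (K S : set E) : is_subfield (adjoin K S).
Proof.
split.
- by apply/mem_set => A [[A1 _ _] _]; exact: set_mem.
- move=> x y /set_mem Lx /set_mem Ly; apply/mem_set => A AP.
  have [[_ AB _] _] := AP.
  by apply/set_mem/AB; apply/mem_set; [exact: Lx|exact: Ly].
- move=> x y /set_mem Lx /set_mem Ly; apply/mem_set => A AP.
  have [[_ _ AV] _] := AP.
  by apply/set_mem/AV; apply/mem_set; [exact: Lx|exact: Ly].
Qed.

Lemma is_subfieldX (E : fieldType) (K : set E) (x : E) (k : nat) :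
  is_subfield K -> K x -> K (x ^+ k).
Proof.
move=> [/set_mem K1 _ KV] Kx; elim: k => [|k Kk]; first by rewrite expr0.
(* Closure is given for division only, so the product is written as a quotient by an inverse. *)
rewrite exprS -[x ^+ k]invrK; apply/set_mem/KV; rewrite inE//.
by rewrite -div1r; apply/set_mem/KV; rewrite inE.
Qed.

Lemma subfield_algebraic (E : fieldType) (K : set E) :
  is_subfield K -> K `<=` algebraic_over K.
Proof.
move=> [K1 KB _] x Kx; exists ('X - x%:P); split.
- rewrite qualifE/= polyseqXsubC/= K1 andbT -[- x]sub0r.
  by rewrite -[0](subrr (1 : E)) !KB// inE.
- by rewrite polyXsubC_eq0.
- by rewrite root_XsubC.
Qed.

(* [b] is a transcendence basis of the field generated by the entries of [a] and
   their exponentials; it even generates this field. *)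
Definition liouville_family (R : realType) (n d : nat) (a : n.-tuple R)
    (b : d.-tuple R) : Prop :=
  [/\ forall i, liouville (tnth a i) /\ liouville (expR (tnth a i)),
      linearly_independent (@rational R) a,
      algebraically_independent (@rational R) b,
      [set` b] `<=` [set` a] `|` expR @` [set` a] &
      forall i, adjoin (@rational R) [set` b] (tnth a i) /\
                adjoin (@rational R) [set` b] (expR (tnth a i))].

Lemma rational_sum (R : realType) (J : Type) (s : seq J) (P : pred J)
    (F : J -> R) :
  (forall j, P j -> rational (F j)) -> rational (\sum_(j <- s | P j) F j).
Proof.
move=> FQ; elim/big_ind: _ => //; first by exists 0; rewrite ?rmorph0.
by move=> _ _ [x _ <-] [y _ <-]; exists (x + y); rewrite ?rmorphD.
Qed.

Lemma mem_pow_exps0 (R : realType) (r : nat) (x : R) : x \in pow_exps r x.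
Proof. by apply/tnthP; exists ord0; rewrite tnth_mktuple. Qed.

Lemma mem_pow_exps (R : realType) (r k : nat) (x : R) :
  (0 < k <= r)%N -> expR (x ^+ k) \in pow_exps r x.
Proof.
move=> /andP[k0 kr]; apply/tnthP; exists (Ordinal (kr : (k < r.+1)%N)).
by rewrite tnth_mktuple -val_eqE/= eqn0Ngt k0.
Qed.

Lemma pow_expsP (R : realType) (r : nat) (x y : R) :
  y \in pow_exps r x -> y = x \/ exists2 k, (0 < k <= r)%N & y = expR (x ^+ k).
Proof.
move=> /tnthP[i ->]; rewrite tnth_mktuple.
have [_|i0] := eqVneq i ord0; first by left.
by right; exists (val i) => //; rewrite lt0n -ltnS ltn_ord andbT.
Qed.

Lemma adjoin_gen (E : fieldType) (K S : set E) (x : E) : S x -> adjoin K S x.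
Proof. by move=> Sx; apply: sub_gen_smallest; right. Qed.

(** A linear relation among powers of [x] is a polynomial relation involving only slot 0 of
    [pow_exps r x]. *)
Lemma linearly_independent_powers (R : realType) (r n : nat) (x : R) :
  algebraically_independent (@rational R) (pow_exps r x) ->
  linearly_independent (@rational R) [tuple x ^+ i.+1 | i < n].
Proof.
move=> x_ind c cQ; under eq_bigr do rewrite tnth_mktuple.
move=> cx i; pose mX := mpolyX R (mnm1 (@ord0 r)) : mpoly r.+1 R.
have mm_inj j k : (mnm_muln (mnm1 (@ord0 r)) j == mnm_muln (mnm1 ord0) k) = (j == k).
  apply/eqP/eqP => [/mnmP/(_ ord0)|->//].
  by rewrite !mulmnE !mnm1E eqxx !mul1n.
pose p := \sum_(j < n) c j *: mX ^+ j.+1.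
have pE m : mcoeff m p = \sum_(j < n) c j * (mnm_muln (mnm1 ord0) j.+1 == m)%:R.
  by rewrite raddf_sum/=; apply: eq_bigr => j _; rewrite mcoeffZ mcoeffXn.
have p0 : p = 0.
  apply: x_ind.
    apply/mpolyOver_inP => m _; rewrite pE; apply: rational_sum => j _.
    by case: eqP; rewrite ?mulr1// mulr0; exists 0; rewrite ?rmorph0.
  rewrite raddf_sum/= -[RHS]cx; apply: eq_bigr => j _.
  by rewrite mevalZ rmorphXn/= mevalXU tnth_mktuple.
have := pE (mnm_muln (mnm1 ord0) i.+1); rewrite p0 mcoeff0 (bigD1 i)//=.
rewrite eqxx mulr1 big1 ?addr0// => j ji.
by rewrite mm_inj eqSS (_ : (j == i :> nat) = false) ?mulr0//; apply/negbTE.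
Qed.

(** The [n.+1] entries have a basis of [n.+2] elements, namely [x] and the [n.+1] exponentials. *)
Lemma liouville_family_powers (R : realType) (n : nat) (C : set R) :
  countable C -> exists2 x : R, ~ C x &
    liouville_family [tuple x ^+ i.+1 | i < n.+1] (pow_exps n.+1 x).
Proof.
move=> cC.
have cQ := countable_rational R.
have [x [Cx x_ind Lx]] := exists_generic n.+1 cQ cC.
exists x => //; split => //.
- by move=> i; rewrite tnth_mktuple; exact: Lx.
- exact: linearly_independent_powers x_ind.
- have xP k : (k < n.+1)%N -> x ^+ k.+1 \in [tuple x ^+ i.+1 | i < n.+1].
    by move=> kn; apply/tnthP; exists (Ordinal kn); rewrite tnth_mktuple.
  move=> y /= /pow_expsP[->|[[//|k] kn ->]].
    by left; rewrite /= -[x]expr1 xP.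
  by right; exists (x ^+ k.+1) => //; exact: xP.
- move=> i; rewrite tnth_mktuple; split.
    apply: (@is_subfieldX _ (adjoin _ _)); first exact: is_subfield_adjoin.
    by apply: adjoin_gen; exact: mem_pow_exps0.
  by apply: adjoin_gen; apply: mem_pow_exps; rewrite ltnS ltn_ord.
Qed.

Lemma liouville_family_cons (R : realType) (n d : nat) (a : n.-tuple R)
    (b : d.-tuple R) :
  liouville_family a b -> exists x : R,
    liouville_family [tuple of x :: a] [tuple of b ++ pow_exps 1 x].
Proof.
move=> [La a_ind b_ind ba ab].
have cQ := countable_rational R.
(* The rational span of [a]: an [x] outside it keeps the extended tuple linearly independent. *)
pose C := range (fun c : {ffun 'I_n -> rat} => \sum_i ratr (c i) * tnth a i : R).
have cC : countable C := sub_countable (card_image_le _ _) (countableP _).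
have cA : countable (poly_values (@rational R) b).
  exact: sub_countable (card_image_le _ _) (countable_mpolyOver _ cQ).
have [x [Cx x_ind Lx]] := exists_generic 1 cA cC.
exists x; split.
- move=> i; case: (unliftP ord0 i) => [j|] ->; rewrite ?tnthS ?tnth0//.
  by rewrite -[x]expr1; exact: Lx.
- move=> c cP; rewrite big_ord_recl tnth0.
  under eq_bigr do rewrite tnthS.
  move=> cx; have c0 : c ord0 = 0.
    apply/eqP/negPn/negP => c0; apply: Cx.
    have /choice[f fE] : forall i, exists q : rat, ratr q = c i.
      by move=> i; have [q _ <-] := cP i; exists q.
    exists [ffun i => - f (lift ord0 i) / f ord0] => //.
    apply: (mulfI c0); move/eqP: cx; rewrite addr_eq0 => /eqP ->.
    rewrite mulr_sumr -sumrN; apply: eq_bigr => i _.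
    rewrite ffunE rmorphM rmorphN fmorphV/= !fE; field.
    by [].
  move: cx; rewrite c0 mul0r add0r => /a_ind cl i.
  by case: (unliftP ord0 i) => [j|] ->//; apply: cl => j'; exact: cP.
- exact: alg_indep_cat.
- move=> y /=; rewrite mem_cat.
  move=> /orP[/ba[ya|[z za <-]]|/pow_expsP[->|[[|[|//]] // _ ->]]].
  + by left; rewrite /= inE ya orbT.
  + by right; exists z => //=; rewrite inE za orbT.
  + by left; rewrite /= inE eqxx.
  + by right; exists x => //=; rewrite inE eqxx.
- have sub : adjoin (@rational R) [set` b] `<=`
      adjoin (@rational R) [set` [tuple of b ++ pow_exps 1 x]].
    apply: sub_smallest2r; first exact: is_subfield_adjoin.
    by apply: setUS => y /= yb; rewrite mem_cat yb.
  move=> i; case: (unliftP ord0 i) => [j|] ->; rewrite ?tnthS ?tnth0.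
    by have [? ?] := ab j; split; exact: sub.
  split; apply: adjoin_gen; rewrite /= mem_cat.
    by rewrite mem_pow_exps0 orbT.
  by rewrite -[X in expR X]expr1 mem_pow_exps ?orbT.
Qed.

(** The induction starts from [s.+1] powers and extends [m] times. The entry outside [C] comes from
    the starting family and persists. *)
Lemma exists_liouville_family (R : realType) (m s : nat) (C : set R) :
  countable C ->
  exists (a : (m.+1 + s).-tuple R) (b : (m.+1 + s + m.+1).-tuple R),
    liouville_family a b /\ exists i, ~ C (tnth a i).
Proof.
(* The length [d] is freed, since concatenation gives it only up to a provable equation. *)
move=> cC; suff [a [d [b [db abP aC]]]] : exists (a : (m.+1 + s).-tuple R) d
    (b : d.-tuple R), [/\ d = (m.+1 + s + m.+1)%N, liouville_family a b &
      exists i, ~ C (tnth a i)].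
  by subst d; exists a, b.
elim: m => [|m [a [d [b [dE abP [i aC]]]]]].
  have [x Cx xP] := liouville_family_powers s cC.
  exists [tuple x ^+ i.+1 | i < s.+1], s.+2, (pow_exps s.+1 x); split=> //.
    by rewrite addn1.
  by exists ord0; rewrite tnth_mktuple.
have [x xP] := liouville_family_cons abP.
exists [tuple of x :: a], _, [tuple of b ++ pow_exps 1 x]; split=> //; first lia.
by exists (lift ord0 i); rewrite tnthS.
Qed.

(** * Transcendence degree and uncountability *)

(** All generators lie in the field generated by [b], so algebraicity over it is trivial. *)
Lemma liouville_family_trdeg (R : realType) (n d : nat) (a : n.-tuple R)
    (b : d.-tuple R) :
  liouville_family a b ->
  trdeg_is (@rational R)
    (adjoin (@rational R) ([set` a] `|` expR @` [set` a])) d.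
Proof.
move=> [_ _ b_ind ba ab]; exists b; split=> //.
  by move=> x /ba; exact: adjoin_gen.
apply: subset_trans (subfield_algebraic (is_subfield_adjoin _ _)).
apply: smallest_sub; first exact: is_subfield_adjoin.
move=> x [xQ|]; first by apply: sub_gen_smallest; left.
by case=> [/tnthP[i ->]|[_ /tnthP[i ->] <-]]; have [] := ab i.
Qed.

Theorem theorem1 (R : realType) (n m : nat) (hn : (1 <= n)%N)
    (hm : (1 <= m <= n)%N) :
  ~ countable [set a : n.-tuple R |
      [/\ forall i, liouville (tnth a i),
          linearly_independent (@rational R) a,
          forall i, liouville (expR (tnth a i)) &
          trdeg_is (@rational R)
            (adjoin (@rational R) ([set` a] `|` expR @` [set` a]))
            (n + m)]].
Proof.
(* If [S] is countable, so is the set [C] of all entries of its tuples; but some tuple of [S] has an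
   entry outside [C]. *)
set S := [set a | _] => cS; pose C := \bigcup_(a in S) [set` a].
have cC : countable C.
  by apply: bigcup_countable => // a _; exact/finite_set_countable/finite_seq.
have [m' [s [mE nE]]] : exists m' s, m = m'.+1 /\ n = (m'.+1 + s)%N.
  by exists m.-1, (n - m)%N; lia.
subst m n; have [a [b [abP [i aC]]]] := exists_liouville_family m' s cC.
apply: aC; exists a; last exact: mem_tnth.
have [La a_ind _ _ _] := abP.
by split=> // [j|j|]; [case: (La j)..|exact: liouville_family_trdeg abP].
Qed.
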